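(* Let $D$ be a non-empty link diagram. Then the signed Shumakovitch operation $\widehat\nu$ induces an endomorphism of $\mathit{Kh}_{h,t}(D)$ with $\widehat\nu^2=0$ and the complex $(\mathit{Kh}_{h,t}(D),\widehat\nu)$ is acyclic, i.e. $\ker\widehat\nu=\operatorname{im}\widehat\nu$ on $\mathit{Kh}_{h,t}(D)$.
   Context: $R_{h,t}=\mathbb{Z}[h,t]$ is graded with $\deg h=2,\ \deg t=4$, and $A_{h,t}=R_{h,t}[X]/(X^2-hX-t)$ with $\deg X=2$. $A_{h,t}$ is a Frobenius $R_{h,t}$-algebra with the usual multiplication $m$ and unit $\iota$, counit $\epsilon(1)=0,\ \epsilon(X)=1$, and comultiplication $\Delta(1)=1\otimes X+X\otimes 1-h(1\otimes 1)$, $\Delta(X)=X\otimes X+t(1\otimes 1)$. For an oriented link diagram $D$ with $n$ crossings ($n_-$ negative), $\mathit{CKh}_{h,t}(D)$ is the Khovanov complex obtained from $A_{h,t}$: to each vertex $v\in\{0,1\}^n$ of the cube of resolutions, whose resolution consists of $k$ circles, one assigns $A_{h,t}^{\otimes k}$ (tensor over $R_{h,t}$), in homological degree $|v|-n_-$; the differential is the sum over edges of $\pm m$ or $\pm\Delta$ with the usual signs. $\mathit{Kh}_{h,t}(D)$ is its homology, here regarded as a bigraded abelian group. The ring involutions $\widehat\sigma_0$ on $R_{h,t}$ and $\widehat\sigma_1$ on $A_{h,t}$ are determined by $\widehat\sigma_0(h)=-h$, $\widehat\sigma_0(t)=t$, $\widehat\sigma_1(X)=X-h$, $\widehat\sigma_1(rx)=\widehat\sigma_0(r)\widehat\sigma_1(x)$;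 put $\widehat\sigma=\widehat\sigma_1^{\otimes k}$ on $A_{h,t}^{\otimes k}$ (and $\widehat\sigma=\widehat\sigma_0$ for $k=0$). The endomorphism $\mathrm{id}-\widehat\sigma$ of $A_{h,t}^{\otimes k}$ is divisible by $h$, and the signed Shumakovitch operation is $\widehat\nu:=(\mathrm{id}-\widehat\sigma)/h$, applied on $\mathit{CKh}_{h,t}(D)$ to each summand $A_{h,t}^{\otimes k}$. It is $\mathbb{Z}[h^2,t]$-linear of degree $-2$ and commutes with the differential. *)

(* Defs.v *)
From HB Require Import structures.
From mathcomp Require Import all_boot all_order all_algebra.
From mathcomp Require Import generic_quotient ring_quotient boolp.

Set Implicit Arguments.
Unset Strict Implicit.
Unset Printing Implicit Defensive.

Import GRing.Theory.
Local Open Scope ring_scope.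

(** * The Frobenius algebra *)

(* Z[h,t] is modelled as Z[t][h]: the outer variable is h, the inner one t. *)
Notation Rht := {poly {poly int}}.

Definition hvar : Rht := 'X.
Definition tvar : Rht := 'X%:P.

Definition frob_poly : {poly Rht} := 'X^2 - hvar *: 'X - tvar%:P.

(* This is the quotient ring R[X]/(frob_poly) because [frob_poly] is monic of
   degree 2, see [mk_monic_frob_poly]. *)
Notation Aht := {poly %/ frob_poly}.

Lemma size_frob_poly : size frob_poly = 3.
Proof.
rewrite /frob_poly -addrA size_polyDl size_polyXn // -opprD size_polyN.
rewrite ltnS (leq_trans (size_polyD _ _)) // geq_max.
rewrite (leq_trans (size_scale_leq _ _)) ?size_polyX //.
by rewrite (leq_trans (size_polyC_leq1 _)).
Qed.

Lemma monic_frob_poly : frob_poly \is monic.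
Proof.
rewrite monicE lead_coefE size_frob_poly /frob_poly /=.
by rewrite 2!coefB coefXn coefZ coefX coefC /= mulr0 !subr0.
Qed.

Lemma mk_monic_frob_poly : mk_monic frob_poly = frob_poly.
Proof. by rewrite /mk_monic size_frob_poly monic_frob_poly. Qed.

Definition Xgen : Aht := 'qX.

(* The R-basis (1, X) of A, indexed by false and true. *)
Definition Abasis (b : bool) : Aht := Xgen ^+ b.
Definition Acoord (b : bool) (a : Aht) : Rht := (a : {poly Rht})`_b.

(* Coefficient of [Abasis c] in m (Abasis a (x) Abasis b). *)
Definition mul_coef (a b c : bool) : Rht := Acoord c (Abasis a * Abasis b).

(* Coefficient of [Abasis b] (x) [Abasis c] in Delta (Abasis a), where
   Delta 1 = 1 (x) X + X (x) 1 - h (1 (x) 1)  and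
   Delta X = X (x) X + t (1 (x) 1). *)
Definition comul_coef (a b c : bool) : Rht :=
  match a, b, c with
  | false, false, false => - hvar
  | false, false, true | false, true, false => 1
  | false, true, true => 0
  | true, false, false => tvar
  | true, true, true => 1
  | true, _, _ => 0
  end.

Definition sigma0 (r : Rht) : Rht := r \Po (- 'X).

Definition sigma1 (a : Aht) : Aht :=
  \sum_(b : bool) sigma0 (Acoord b a) *: (Xgen - hvar%:A) ^+ b.

Lemma Acoord_is_zmod_morphism b : zmod_morphism (Acoord b).
Proof. by move=> x y; rewrite /Acoord raddfB coefB. Qed.
HB.instance Definition _ b := GRing.isZmodMorphism.Build Aht Rht (Acoord b)
  (Acoord_is_zmod_morphism b).

Lemma AcoordZ b (r : Rht) (a : Aht) : Acoord b (r *: a) = r * Acoord b a.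
Proof. by rewrite /Acoord linearZ coefZ. Qed.

Lemma Acoord_Abasis b b' : Acoord b (Abasis b') = (b == b')%:R.
Proof.
rewrite /Acoord /Abasis /Xgen; case: b'; rewrite ?expr1 ?expr0.
  rewrite qpolyXE ?size_frob_poly ?monic_frob_poly // coefX.
  by case: b.
by rewrite -[polyn _]/(1%:P) coefC; case: b.
Qed.

Lemma Xgen_sqr : Xgen ^+ 2 = hvar *: Xgen + tvar%:A.
Proof.
have: in_qpoly frob_poly ('X^2 - (hvar *: 'X + tvar%:P)) = 0.
  rewrite opprD addrA -/frob_poly; apply: val_inj.
  by rewrite /= mk_monic_frob_poly Pdiv.RingMonic.rmodpp ?monic_frob_poly.
move/eqP; rewrite rmorphB rmorphXn rmorphD /= subr_eq0 in_qpolyZ => /eqP ->.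
by rewrite -alg_polyC in_qpolyZ rmorph1.
Qed.

Lemma sigma1_Abasis b : sigma1 (Abasis b) = (Xgen - hvar%:A) ^+ b.
Proof.
rewrite /sigma1 (bigD1 b) //= big1 => [|b' /negPf nb].
  by rewrite Acoord_Abasis eqxx /sigma0 rmorph1 scale1r addr0.
by rewrite Acoord_Abasis nb /sigma0 rmorph0 scale0r.
Qed.

(** * Tensor powers of A over R *)

(* A is free over R on 1, X, so the tensor power of A indexed by the finite
   set C is free on the labelings of C by {1, X}; elements are given by their
   coordinates. *)
Definition labeling (C : finType) := {ffun C -> bool}.
Definition tpow (C : finType) := {ffun labeling C -> Rht}.

Definition pure_tensor (C : finType) (a : C -> Aht) : tpow C :=
  [ffun s : labeling C => \prod_(c : C) Acoord (s c) (a c)].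

(* sigma1^{(x) C}, semilinear with respect to sigma0. *)
Definition tsigma (C : finType) (x : tpow C) : tpow C :=
  [ffun s' : labeling C => \sum_(s : labeling C)
     sigma0 (x s) * pure_tensor (fun c => sigma1 (Abasis (s c))) s'].

(* The division by h is exact, see [tnuP] below. *)
Definition tnu (C : finType) (x : tpow C) : tpow C :=
  [ffun s : labeling C => (x s - tsigma x s) %/ hvar].

Lemma tnuP (C : finType) (x : tpow C) s :
  hvar * tnu x s = x s - tsigma x s.
Proof.
rewrite /tnu ffunE [hvar * _]mulrC; apply/esym/eqP.
rewrite -(Pdiv.IdomainMonic.dvdp_eq (monicX _)) -['X]subr0 -polyC0 dvdp_XsubCl /root.
rewrite hornerD hornerN subr_eq0 /tsigma ffunE horner_sum (bigD1 s) //=.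
have Asigma b b' : (Acoord b (sigma1 (Abasis b'))).[0] = (b == b')%:R :> {poly int}.
  rewrite sigma1_Abasis; case: b'; rewrite ?expr1 ?expr0.
    rewrite raddfB /= AcoordZ -[1]/(Abasis false) -[Xgen]/(Abasis true).
    rewrite !Acoord_Abasis hornerD hornerN hornerM hornerX mul0r subr0.
    by case: b; rewrite ?hornerC.
  by rewrite -[1]/(Abasis false) Acoord_Abasis; case: b; rewrite ?hornerC.
have sigma00 (r : Rht) : (sigma0 r).[0] = r.[0].
  by rewrite /sigma0 horner_comp hornerN hornerX oppr0.
rewrite big1 => [|s' /eqP s's].
  rewrite addr0 hornerM sigma00 ffunE horner_prod big1 ?mulr1 // => c _.
  by rewrite Asigma eqxx.
have [c /negPf sc] : exists c, s c != s' c.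
  apply/existsP; apply: contra_notT s's => /existsPn ss.
  by apply/ffunP => c; move/eqP: (negbNE (ss c)).
by rewrite hornerM ffunE horner_prod (bigD1 c) //= Asigma sc mul0r mulr0.
Qed.

(** * Link diagrams *)

(* A dart (i, k) is the k-th half-edge at the crossing i; the four half-edges
   are numbered counterclockwise, starting from the incoming end of the
   under-strand (the convention of planar diagram codes). *)
Definition dart (n : nat) : predArgType := ('I_n * 'I_4)%type.

Definition next_dart n (x : dart n) : dart n := (x.1, ordS x.2).

(* The under-strand runs from 0 to 2; the over-strand runs from 3 to 1 at a
   positive crossing and from 1 to 3 at a negative one. *)
Definition outgoing n (positive : 'I_n -> bool) (x : dart n) : bool :=
  nth false [:: false; positive x.1; true; ~~ positive x.1] x.2.

(* An oriented link diagram, up to planar isotopy: the 4-valent planar graph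
   of its crossings, given as an oriented combinatorial map [edge] matching
   the two ends of every edge, together with [ncircles] further components
   without crossings.  How the connected components of the diagram are nested in
   one another is not recorded: the cube of resolutions does not see it.
   [diagram_planar] is Euler's formula V + F = E + 2 C for that graph, which
   has 2 V edges. *)
Record link_diagram := LinkDiagram {
  ncrossings : nat;
  ncircles : nat;
  positive : 'I_ncrossings -> bool;
  edge : dart ncrossings -> dart ncrossings;
  edgeK : involutive edge;
  edge_oriented : forall x,
    outgoing positive (edge x) = ~~ outgoing positive x;
  diagram_planar :
    (ncrossings + fcard (fun x => next_dart (edge x)) (dart ncrossings) =
     2 * ncrossings +
     2 * n_comp (fun x y => (y == edge x) || (y == next_dart x))
                (dart ncrossings))%N
}.

Definition nonempty_diagram (D : link_diagram) : Prop :=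
  (0 < ncrossings D + ncircles D)%N.

Definition nneg (D : link_diagram) : nat := #|[pred i | ~~ @positive D i]|.
Definition npos (D : link_diagram) : nat := #|[pred i | @positive D i]|.

(** * The cube of resolutions *)

Definition vertex (D : link_diagram) := {ffun 'I_(ncrossings D) -> bool}.

Definition weight D (v : vertex D) : nat := #|[pred i | v i]|.

(* The 0-smoothing joins 0 with 1 and 2 with 3 (it is the oriented smoothing
   of a positive crossing); the 1-smoothing joins 0 with 3 and 1 with 2. *)
Definition smoothing D (v : vertex D) (x : dart (ncrossings D)) :
    dart (ncrossings D) :=
  (x.1, if v x.1 then rev_ord x.2
        else if odd x.2 then ord_pred x.2 else ordS x.2).

Definition arc (D : link_diagram) : predArgType :=
  (dart (ncrossings D) + 'I_(ncircles D))%type.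

Definition linked D (v : vertex D) : rel (arc D) := fun a b =>
  match a, b with
  | inl x, inl y => (y == edge x) || (y == smoothing v x)
  | _, _ => false
  end.

Definition circle_set D (v : vertex D) (a : arc D) : {set arc D} :=
  [set b | connect (linked v) a b].

Definition circle D (v : vertex D) :=
  {c : {set arc D} | c \in [set circle_set v a | a in [set: arc D]]}.
HB.instance Definition _ D (v : vertex D) := Finite.on (circle v).

Definition circle_of D (v : vertex D) (a : arc D) : circle v :=
  exist _ (circle_set v a) (imset_f (circle_set v) (in_setT a)).

(** * The Khovanov complex *)

(* The matrix coefficient, in the bases of labelings, of the map
   A^{(x) circles of v} -> A^{(x) circles of v'} on an edge v -> v' of the cube
   changing the crossing i: it is the identity on the circles common to v and
   v', and m or Delta on the others.  The circles of either resolution that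
   meet the crossing i are those through (i, 0) and through (i, 2). *)
Definition edge_coef D (v v' : vertex D) (i : 'I_(ncrossings D))
    (s : labeling (circle v)) (s' : labeling (circle v')) : Rht :=
  let p : arc D := inl (i, inord 0) in
  let q : arc D := inl (i, inord 2) in
  if [forall c : circle v, forall c' : circle v',
        (val c == val c') ==> (s c == s' c')]
  then if circle_of v p != circle_of v q
       then mul_coef (s (circle_of v p)) (s (circle_of v q))
                     (s' (circle_of v' p))
       else comul_coef (s (circle_of v p))
                       (s' (circle_of v' p)) (s' (circle_of v' q))
  else 0.

Definition edge_map D (v v' : vertex D) (i : 'I_(ncrossings D))
    (x : tpow (circle v)) : tpow (circle v') :=
  [ffun s' => \sum_(s : labeling (circle v)) x s * edge_coef i s s'].

Definition generator (D : link_diagram) :=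
  {v : vertex D & labeling (circle v)}.
HB.instance Definition _ D := Finite.on (generator D).

(* The direct sum of the tensor powers over all vertices of the cube. *)
Definition CKh (D : link_diagram) := {ffun generator D -> Rht}.
HB.instance Definition _ D := GRing.Zmodule.on (CKh D).

Definition component D (x : CKh D) (v : vertex D) : tpow (circle v) :=
  [ffun s => x (Tagged (fun v => labeling (circle v)) s)].

Definition of_components D (x : forall v : vertex D, tpow (circle v)) : CKh D :=
  [ffun g => x (tag g) (tagged g)].

Definition unset_bit D (v : vertex D) (i : 'I_(ncrossings D)) : vertex D :=
  [ffun j => (j != i) && v j].

Definition edge_sign D (v : vertex D) (i : 'I_(ncrossings D)) : Rht :=
  (-1) ^+ #|[pred j : 'I_(ncrossings D) | (j < i)%N && v j]|.

Definition differential D (x : CKh D) : CKh D :=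
  of_components (fun v' => [ffun s' => \sum_(i | v' i)
    edge_sign v' i *
    edge_map v' i (component x (unset_bit v' i)) s']).

Lemma differential_is_zmod_morphism D : zmod_morphism (@differential D).
Proof.
move=> x y; apply/ffunP => g; rewrite !ffunE -sumrB; apply: eq_bigr => i _.
rewrite !ffunE -mulrBr -sumrB; congr (_ * _); apply: eq_bigr => s _.
by rewrite !ffunE mulrBl.
Qed.
HB.instance Definition _ D := GRing.isZmodMorphism.Build (CKh D) (CKh D)
  (@differential D) (@differential_is_zmod_morphism D).

Definition nu D (x : CKh D) : CKh D :=
  of_components (fun v => tnu (component x v)).

(** * Homology *)

Definition cycle_pred (V : zmodType) (d : {additive V -> V}) : pred V :=
  fun x => d x == 0.

Lemma cycle_zmod_closed (V : zmodType) (d : {additive V -> V}) :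
  zmod_closed (cycle_pred d).
Proof.
split=> [|x y]; first by rewrite unfold_in /cycle_pred raddf0.
by rewrite !unfold_in /cycle_pred raddfB => /eqP-> /eqP->; rewrite subrr.
Qed.
HB.instance Definition _ (V : zmodType) (d : {additive V -> V}) :=
  GRing.isZmodClosed.Build V (cycle_pred d) (cycle_zmod_closed d).

Record cycle_of (V : zmodType) (d : {additive V -> V}) :=
  Cycle { chain : V; chainP : chain \in cycle_pred d }.
HB.instance Definition _ (V : zmodType) (d : {additive V -> V}) :=
  [isSub for @chain V d].
HB.instance Definition _ (V : zmodType) (d : {additive V -> V}) :=
  [Choice of cycle_of d by <:].
HB.instance Definition _ (V : zmodType) (d : {additive V -> V}) :=
  [SubChoice_isSubZmodule of cycle_of d by <:].

Definition boundary_pred (V : zmodType) (d : {additive V -> V}) :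
    pred (cycle_of d) :=
  fun z => `[< exists y : V, d y = chain z >].

Lemma boundary_zmod_closed (V : zmodType) (d : {additive V -> V}) :
  zmod_closed (@boundary_pred V d).
Proof.
split=> [|x y]; first by apply/asboolP; exists 0; rewrite raddf0.
move=> /asboolP[a da] /asboolP[b db]; apply/asboolP; exists (a - b).
by rewrite raddfB da db.
Qed.
HB.instance Definition _ (V : zmodType) (d : {additive V -> V}) :=
  GRing.isZmodClosed.Build (cycle_of d) (@boundary_pred V d)
    (@boundary_zmod_closed V d).

Definition boundaries (V : zmodType) (d : {additive V -> V}) :
    zmodClosed (cycle_of d) :=
  GRing.ZmodClosed.clone (cycle_of d) (@boundary_pred V d) _.

(* The kernel of d modulo the boundaries lying in it; for d o d = 0 this is the
   usual ker d / im d. *)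
Definition homology (V : zmodType) (d : {additive V -> V}) :=
  {ideal_quot (boundaries d)}.
HB.instance Definition _ (V : zmodType) (d : {additive V -> V}) :=
  GRing.Zmodule.on (homology d).

Definition homology_class (V : zmodType) (d : {additive V -> V})
  (z : cycle_of d) : homology d := \pi_({ideal_quot (boundaries d)})%qT z.

Lemma homology_classP (V : zmodType) (d : {additive V -> V})
    (z z' : cycle_of d) :
  homology_class z = homology_class z' <->
  exists y : V, d y = chain z - chain z'.
Proof.
split=> [/eqP|dy].
  by rewrite -Quotient.idealrBE => /asboolP.
by apply/eqP; rewrite -Quotient.idealrBE; apply/asboolP.
Qed.

(* f maps cycles to cycles, and fH is the map it induces in homology. *)
Definition induces (V : zmodType) (d : {additive V -> V}) (f : V -> V)
    (fH : homology d -> homology d) : Prop :=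
  forall z : cycle_of d, exists2 z' : cycle_of d,
    chain z' = f (chain z) & fH (homology_class z) = homology_class z'.

Definition Kh (D : link_diagram) := homology (@differential D).
HB.instance Definition _ D := GRing.Zmodule.on (Kh D).

(** * The bigrading *)

Definition hdeg (D : link_diagram) (g : generator D) : int :=
  (weight (tag g))%:Z - (nneg D)%:Z.

(* Quantum degree of h^a t^b times the generator g.  As deg X = 2, each circle
   contributes -1 for the label 1 and +1 for the label X, and the further shift
   is - |v| - n_+ + 2 n_-: this is the convention opposite to the one where
   deg X = -2.  The differential has bidegree (1, 0). *)
Definition qdeg (D : link_diagram) (g : generator D) (a b : nat) : int :=
  (2 * a + 4 * b)%:Z
  + (\sum_(c : circle (tag g)) (if tagged g c then 1 else -1))
  - (weight (tag g))%:Z - (npos D)%:Z + (2 * nneg D)%:Z.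

Definition bihomogeneous (D : link_diagram) (i j : int) (x : CKh D) : Prop :=
  forall (g : generator D) (a b : nat), (x g)`_a`_b != 0 ->
    hdeg g = i /\ qdeg g a b = j.

(* The subgroup Kh^{i,j} of Kh. *)
Definition Kh_bihomogeneous (D : link_diagram) (i j : int) (y : Kh D) : Prop :=
  exists2 z : cycle_of (@differential D),
    bihomogeneous i j (chain z) & homology_class z = y.

(* Main.v *)
Require Import Defs.
From HB Require Import structures.
From mathcomp Require Import all_boot all_order all_algebra all_fingroup.
From mathcomp Require Import zify ring.
From mathcomp Require Import generic_quotient ring_quotient boolp.

Set Implicit Arguments.
Unset Strict Implicit.
Unset Printing Implicit Defensive.

Import GRing.Theory.
Local Open Scope ring_scope.

(** Write sigma for the semilinear involution of the complex, so h nu = 1 - sigma.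
    As sigma^2 = 1 and sigma (h x) = - h (sigma x), sigma fixes the image of nu,
    whence nu^2 = 0.  For a point a of the diagram, multiplication X_a by X on the
    circle through a is a chain map, and sigma X_a = (X_a - h) sigma gives
    nu X_a - (X_a - h) nu = 1: a class killed by nu is the image of its product
    with X_a.

    That sigma and X_a are chain maps needs every edge of the cube to merge two
    circles or to split one, and this is where planarity enters.  Euler's formula
    and a rank count over F_2 give a checkerboard colouring of the faces.  Followed
    along one colour, the circles of a resolution become the cycles of a
    permutation of half-edges; changing a smoothing multiplies it by a
    transposition, which merges two cycles or splits one. *)

(** * Checkerboard colourings of planar maps *)

Lemma connect_invariant (T : finType) (S : Type) (r : rel T) (f : T -> S) :
  (forall x y, r x y -> f x = f y) -> forall x y, connect r x y -> f x = f y.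
Proof.
move=> fr x y /connectP[s + ->].
by elim: s x => //= z s IHs x /andP[/fr-> /IHs].
Qed.

(** Selecting rows or columns is multiplication by a matrix, which cannot raise the rank. The lower
    bounds below all come from exhibiting an identity submatrix. *)
Lemma rank_ge_mxsub (F : fieldType) m n k (A : 'M[F]_(m, n))
    (f : 'I_k -> 'I_m) (g : 'I_k -> 'I_n) :
  mxsub f g A = 1%:M -> (k <= \rank A)%N.
Proof.
move=> A1; rewrite -(mxrank1 F k) -A1 mxsubrc rowsubE.
rewrite (leq_trans (mxrankM_maxr _ _)) //.
have -> : colsub g A = A *m colsub g 1%:M by rewrite mulmx_colsub mulmx1.
exact: mxrankM_maxl.
Qed.

(** A row constant on components is determined by its values at the roots, so [U] factors through a
    matrix with one column per component. *)
Lemma rank_root_invariant (F : fieldType) (T : finType) (r : rel T) m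
    (U : 'M[F]_(m, #|T|)) : connect_sym r ->
  (forall i x y, r x y -> U i (enum_rank x) = U i (enum_rank y)) ->
  (\rank U <= n_comp r T)%N.
Proof.
move=> r_sym Ur; set a := predI (roots r) (mem T).
pose R : 'M[F]_(#|a|, #|T|) :=
  \matrix_(k, j) (enum_val k == fingraph.root r (enum_val j))%:R.
suff -> : U = colsub (fun k : 'I_#|a| => enum_rank (enum_val k)) U *m R.
  by rewrite (leq_trans (mxrankM_maxr _ _)) // rank_leq_row.
apply/matrixP => i j; rewrite mxE.
have aj : fingraph.root r (enum_val j) \in a by rewrite !inE andbT; apply: roots_root.
rewrite (bigD1 (enum_rank_in aj (fingraph.root r (enum_val j)))) //= big1 => [|k kj].
  rewrite !mxE enum_rankK_in // eqxx mulr1 addr0 -{1}(enum_valK j).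
  exact: (connect_invariant (Ur i) (connect_root _ _)).
rewrite !mxE; case: eqP => [k_root|]; rewrite ?mulr0 //.
by case/eqP: kj; apply: enum_val_inj; rewrite enum_rankK_in.
Qed.

Section Checkerboard.

Variables (n : nat) (e : dart n -> dart n).

(** Row vectors are F_2-valued functions on darts. Right multiplication sends u to u + u o e, so its
    kernel consists of the e-invariant functions, that is, of the sets of edges. *)
Definition map_edge_mx : 'M['F_2]_#|dart n| := \matrix_(i, j)
  ((j == i)%:R + (enum_val j == e (enum_val i))%:R).

Definition map_vertex_mx : 'M['F_2]_#|dart n| :=
  \matrix_(i, j) ((enum_val i).1 == (enum_val j).1)%:R.

(* The face on one side of the dart x is its orbit under [next_dart \o e]; the
   rows are the indicators of the faces. *)
Definition map_face_mx :
    'M['F_2]_(fcard (fun x => next_dart (e x)) (dart n), #|dart n|) :=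
  \matrix_(k, j)
    (enum_val k == froot (fun x => next_dart (e x)) (enum_val j))%:R.

Hypothesis eK : involutive e.

Lemma mul_map_edge_mx m (U : 'M_(m, #|dart n|)) i x :
  (U *m map_edge_mx) i (enum_rank x) = U i (enum_rank x) + U i (enum_rank (e x)).
Proof.
rewrite mxE; under eq_bigr do rewrite mxE mulrDr.
rewrite big_split /=; congr (_ + _).
  rewrite (bigD1 (enum_rank x)) //= big1 => [|j jx].
    by rewrite eqxx mulr1 addr0.
  by rewrite eq_sym (negPf jx) mulr0.
rewrite (bigD1 (enum_rank (e x))) //= big1 => [|j jx].
  by rewrite !enum_rankK eK eqxx mulr1 addr0.
rewrite enum_rankK; case: eqP => [xj|]; rewrite ?mulr0 //.
by rewrite xj eK enum_valK eqxx in jx.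
Qed.

Lemma mul_map_vertex_mx m (U : 'M_(m, #|dart n|)) i x :
  (U *m map_vertex_mx) i (enum_rank x) = \sum_k U i (enum_rank (x.1, k)).
Proof.
rewrite mxE (reindex enum_rank); last by apply: onW_bij; apply: enum_rank_bij.
transitivity (\sum_a \sum_b U i (enum_rank (a, b)) *
    map_vertex_mx (enum_rank (a, b)) (enum_rank x)).
  by rewrite pair_bigA; apply: eq_bigr => [[a b]].
rewrite (bigD1 x.1) //= [X in _ + X]big1 => [|a ax].
  rewrite addr0; apply: eq_bigr => k _.
  by rewrite mxE !enum_rankK /= eqxx mulr1.
by apply: big1 => k _; rewrite mxE !enum_rankK /= (negPf ax) mulr0.
Qed.

Lemma next_dart_inj : injective (@next_dart n).
Proof.
move=> [a b] [c d] E; have /= -> := congr1 fst E.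
by have /= /(can_inj (@ordSK _)) -> := congr1 snd E.
Qed.

Lemma iter_next_dart (x : dart n) : iter 4 (@next_dart n) x = x.
Proof.
case: x => a b; congr (_, _); apply: val_inj => /=.
by case: b => [[|[|[|[|]]]]].
Qed.

Definition map_rel : rel (dart n) :=
  fun x y => (y == e x) || (y == next_dart x).

Lemma map_rel_sym : connect_sym map_rel.
Proof.
suff r_sym x y : map_rel x y -> connect map_rel y x.
  have sub x y : connect map_rel x y -> connect map_rel y x.
    move=> /connectP[s + ->]; elim: s x => [|z s IHs] x /=; first by rewrite connect0.
    by case/andP => /r_sym zx /IHs; move=> /connect_trans; apply.
  by move=> x y; apply/idP/idP; apply: sub.
case/orP=> /eqP->; first by apply: connect1; rewrite /map_rel eK eqxx.
have nx z : connect map_rel z (next_dart z).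
  by apply: connect1; rewrite /map_rel eqxx orbT.
rewrite -{2}(iter_next_dart x) /=.
do 2!apply: connect_trans (nx _).
exact: nx.
Qed.

Local Notation face_perm := (fun x => next_dart (e x)).

Lemma face_perm_sym : connect_sym (frel face_perm).
Proof.
by apply: fconnect_sym => x y /next_dart_inj /(can_inj eK).
Qed.

Lemma rank_map_face_mx : \rank map_face_mx = fcard face_perm (dart n).
Proof.
apply/eqP; rewrite eqn_leq rank_leq_row /=.
apply: (@rank_ge_mxsub _ _ _ _ _ id (fun k => enum_rank (enum_val k))).
apply/matrixP => k l; rewrite !mxE enum_rankK.
have /andP[/eqP-> _] : enum_val l \in predI (froots face_perm) (mem (dart n)).
  exact: enum_valP.
by rewrite (inj_eq enum_val_inj).
Qed.

Lemma rank_map_vertex_mx : (n <= \rank map_vertex_mx)%N.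
Proof.
apply: (@rank_ge_mxsub _ _ _ _ _ (fun i => enum_rank (i, ord0))
  (fun i => enum_rank (i, ord0))).
by apply/matrixP => i j; rewrite !mxE !enum_rankK.
Qed.

Variable out : pred (dart n).
Hypothesis out_e : forall x, out (e x) = ~~ out x.

Lemma card_outgoing : #|out| = (2 * n)%N.
Proof.
have : (#|out| + #|predC out| = 4 * n)%N by rewrite cardC card_prod !card_ord mulnC.
have -> : #|predC out| = #|out|.
  rewrite -(card_image (can_inj eK)); apply: eq_card => x.
  apply/imageP/idP => [[y outy ->]|outx]; first by rewrite unfold_in out_e.
  by exists (e x); rewrite ?eK // inE /= out_e negbK.
by move=> E; apply/double_inj; rewrite -addnn E -mul2n mulnA.
Qed.

(** The outgoing darts, one for each edge, index an identity submatrix: [e] takes an outgoing dart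
    to an incoming one, so the second term of each entry vanishes there. *)
Lemma rank_map_edge_mx : (2 * n <= \rank map_edge_mx)%N.
Proof.
rewrite -card_outgoing.
apply: (@rank_ge_mxsub _ _ _ _ _ (fun i => enum_rank (enum_val i))
  (fun i => enum_rank (enum_val i))).
apply/matrixP => i j; rewrite !mxE !enum_rankK (inj_eq enum_rank_inj).
rewrite (inj_eq enum_val_inj) [i == j]eq_sym.
case: (enum_val j =P e (enum_val i)) => [ji|_]; last by rewrite addr0.
have := enum_valP i; have := enum_valP j; by rewrite !unfold_in ji out_e => /negPf->.
Qed.

Hypothesis euler : (n + fcard face_perm (dart n) =
  2 * n + 2 * n_comp map_rel (dart n))%N.

Lemma F2_addr_eq0 (a b : 'F_2) : (a + b = 0) -> a = b.
Proof. by move: a b; do 2![case=> [[|[|]]] //= ?]; move=> //= ?; apply: val_inj. Qed.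

Lemma F2_addxx (a : 'F_2) : a + a = 0.
Proof. by case: a => [[|[|]]] //= ?; apply: val_inj. Qed.

Lemma map_face_mx_invariant k x :
  map_face_mx k (enum_rank (next_dart (e x))) = map_face_mx k (enum_rank x).
Proof.
rewrite !mxE !enum_rankK; congr (_ == _)%:R; apply/esym.
exact/(fingraph.rootP face_perm_sym)/fconnect1.
Qed.

(** A sum of faces with zero boundary is invariant under [e], and under [next_dart \o e] like every
    sum of faces. Hence it is constant on the components of the map, which bounds the kernel. *)
Lemma rank_face_boundary :
  (fcard face_perm (dart n) - n_comp map_rel (dart n)
     <= \rank (map_face_mx *m map_edge_mx))%N.
Proof.
rewrite -[X in (X - _)%N]rank_map_face_mx leq_subLR.
rewrite -(mxrank_mul_ker map_face_mx map_edge_mx) addnC leq_add2r.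
apply: rank_root_invariant => [|i x y].
  exact: map_rel_sym.
set U := (_ :&: _)%MS.
have /sub_kermxP UA : (U <= kermx map_edge_mx)%MS by apply: capmxSr.
have Ue z : U i (enum_rank z) = U i (enum_rank (e z)).
  apply: F2_addr_eq0; rewrite -mul_map_edge_mx UA mxE //.
have /submxP[V UV] : (U <= map_face_mx)%MS by apply: capmxSl.
case/orP=> /eqP->; first exact: Ue.
rewrite -{2}(eK x) Ue UV !mxE; apply: eq_bigr => k _.
by rewrite map_face_mx_invariant.
Qed.

(** The kernel consists of the edge sets meeting every vertex evenly. Both matrices are symmetric,
    so its dimension is 4n minus the rank of the sum of their row spaces. These have ranks at least
    2n and n, and a common vector is constant on edges and on vertices, hence on components. *)
Lemma rank_cycle_space :
  (\rank (kermx (row_mx map_edge_mx map_vertex_mx)) <= n + n_comp map_rel (dart n))%N.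
Proof.
have Asym : map_edge_mx^T = map_edge_mx.
  apply/matrixP => i j; rewrite !mxE eq_sym; congr (_ + _%:R).
  by rewrite -{1}(inj_eq (can_inj eK)) eK eq_sym.
have Ssym : map_vertex_mx^T = map_vertex_mx.
  by apply/matrixP => i j; rewrite !mxE eq_sym.
rewrite mxrank_ker -mxrank_tr tr_row_mx Asym Ssym -addsmxE leq_subLR.
have := mxrank_sum_cap map_edge_mx map_vertex_mx.
have cap : (\rank (map_edge_mx :&: map_vertex_mx) <= n_comp map_rel (dart n))%N.
  apply: rank_root_invariant => [|i x y]; first exact: map_rel_sym.
  set U := (_ :&: _)%MS.
  have /submxP[V UV] : (U <= map_edge_mx)%MS by apply: capmxSl.
  have /submxP[W UW] : (U <= map_vertex_mx)%MS by apply: capmxSr.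
  case/orP=> /eqP->; last by rewrite UW !mul_map_vertex_mx.
  by rewrite UV !mul_map_edge_mx eK addrC.
have : #|dart n| = (4 * n)%N by rewrite card_prod !card_ord mulnC.
move: rank_map_vertex_mx rank_map_edge_mx cap; lia.
Qed.

(* By the two rank bounds and Euler's formula, the boundaries of sums of faces are
   exactly the edge sets meeting every vertex evenly; the set of all edges is one,
   as the map is 4-valent. *)
Lemma checkerboard : exists f : dart n -> bool,
  (forall x, f (e x) = ~~ f x) /\ (forall x, f (next_dart x) = ~~ f x).
Proof.
pose Z := kermx (row_mx map_edge_mx map_vertex_mx).
have WZ : (map_face_mx *m map_edge_mx <= Z)%MS.
  apply/sub_kermxP; rewrite mul_mx_row -[RHS]row_mx0; congr row_mx.
    apply/matrixP => i j; rewrite -(enum_valK j) !mul_map_edge_mx eK [RHS]mxE.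
    by rewrite [X in _ + X]addrC F2_addxx.
  apply/matrixP => i j; rewrite -(enum_valK j) !mul_map_vertex_mx [RHS]mxE.
  under eq_bigr do rewrite mul_map_edge_mx.
  (* Turning once around the vertex pairs the value at [next_dart y] with the value at [e y]; these
     two darts lie on the same face. *)
  rewrite big_split /= (reindex_inj (can_inj (@ordSK 4))) /= -big_split big1 //= => k _.
  rewrite -[X in map_face_mx _ (enum_rank X) + _]/(next_dart ((enum_val j).1, k)).
  by rewrite -{1}[((enum_val j).1, k)]eK map_face_mx_invariant F2_addxx.
(* With F faces and c components, Euler's formula reads F - c = n + c, so the two rank bounds
   coincide. *)
have ZW : (Z <= map_face_mx *m map_edge_mx)%MS.
  rewrite -(geq_leqif (mxrank_leqif_sup WZ)).
  rewrite (leq_trans rank_cycle_space) // (leq_trans _ rank_face_boundary) //.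
  move: euler; lia.
have : ((const_mx 1 : 'rV_#|dart n|) <= Z)%MS.
  apply/sub_kermxP; rewrite mul_mx_row -[RHS]row_mx0; congr row_mx.
    apply/matrixP => i j; rewrite -(enum_valK j) mul_map_edge_mx !mxE.
    exact: val_inj.
  apply/matrixP => i j; rewrite -(enum_valK j) mul_map_vertex_mx mxE.
  under eq_bigr do rewrite mxE.
  by rewrite sumr_const card_ord; apply: val_inj.
move=> /submx_trans/(_ ZW)/submxP[u u1].
(* The sum [u] of faces has every edge in its boundary. A dart is coloured by whether its face
   occurs in [u]: the colour is constant on faces and changes across each edge. *)
pose g x := (u *m map_face_mx) 0 (enum_rank x).
have ge x : g x + g (e x) = 1.
  by rewrite /g -mul_map_edge_mx -mulmxA -u1 mxE.
have gf x : g (next_dart (e x)) = g x.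
  rewrite /g !mxE; apply: eq_bigr => k _.
  by rewrite map_face_mx_invariant.
have neg (a b : 'F_2) : a + b = 1 -> (b == 1) = ~~ (a == 1).
  by case: a b => [[|[|]]] //= ? [[|[|]]] //= ?.
exists (fun x => g x == 1); split=> x; first exact: (neg _ _ (ge x)).
by rewrite -{1}[x]eK gf (neg _ _ (ge x)).
Qed.

End Checkerboard.

(** * Circles of resolutions *)

Lemma diagram_checkerboard D : exists f : dart (ncrossings D) -> bool,
  (forall x, f (edge x) = ~~ f x) /\ (forall x, f (next_dart x) = ~~ f x).
Proof.
apply: (@checkerboard _ (@edge D) (@edgeK D) (outgoing (@positive D))).
  exact: edge_oriented.
exact: diagram_planar.
Qed.

Lemma inord0_I4 : inord 0 = ord0 :> 'I_4.
Proof. by apply: val_inj; rewrite /= inordK. Qed.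

Lemma inord2_I4 : inord 2 = Ordinal (isT : 2 < 4)%N :> 'I_4.
Proof. by apply: val_inj; rewrite /= inordK. Qed.

Section Smoothings.

Variable D : link_diagram.
Implicit Types (v : vertex D) (i : 'I_(ncrossings D)) (a b : Defs.arc D).

Lemma smoothingK v : involutive (smoothing v).
Proof.
move=> [i k]; rewrite /smoothing /=; case: (v i).
  by rewrite rev_ordK.
by congr (_, _); case: k => [[|[|[|[|]]]] //= lt_k]; apply: val_inj.
Qed.

Lemma linked_sym v : symmetric (linked v).
Proof.
move=> [x|j] [y|l] //=; congr (_ || _); apply/eqP/eqP => ->.
- by rewrite edgeK.
- by rewrite edgeK.
- by rewrite smoothingK.
by rewrite smoothingK.
Qed.

Lemma connect_linked_sym v : connect_sym (linked v).
Proof. exact: sym_connect_sym (linked_sym v). Qed.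

Lemma circle_of_eq v a b :
  (circle_of v a == circle_of v b) = connect (linked v) a b.
Proof.
apply/eqP/idP => [/(congr1 val) /= ab|ab].
  have: b \in circle_set v b by rewrite inE connect0.
  by rewrite -ab inE.
apply: val_inj; apply/setP => c; rewrite !inE.
exact: (same_connect (connect_linked_sym v) ab).
Qed.

Lemma circle_ofP v (c : circle v) : exists a, c = circle_of v a.
Proof.
case: c => c cP; have /imsetP[a _ ca] := cP.
by exists a; apply: val_inj.
Qed.

Definition under_in i : Defs.arc D := inl (i, inord 0).
Definition under_out i : Defs.arc D := inl (i, inord 2).

(** The arcs on the circles of [v] that meet the crossing [i]. Two of the four half-edges suffice,
    since either smoothing joins 1 and 3 to 0 and 2 in some order. *)
Definition touches v i : pred (Defs.arc D) := fun a =>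
  connect (linked v) (under_in i) a || connect (linked v) (under_out i) a.

Lemma touches_crossing v i k : touches v i (inl (i, k)).
Proof.
rewrite /touches; have sm x : connect (linked v) (inl x) (inl (smoothing v x)).
  by apply: connect1; rewrite /= eqxx orbT.
have := sm (i, inord 0); have := sm (i, inord 2).
rewrite /under_in /under_out inord0_I4 inord2_I4 /smoothing /=.
case: (v i); case: k => [[|[|[|[|]]]] //= lt_k].
- by move=> _ _; rewrite (_ : Ordinal _ = ord0) ?connect0 //; apply: val_inj.
- by move=> + _; rewrite (_ : rev_ord _ = Ordinal lt_k) => [->|]; rewrite ?orbT //; apply: val_inj.
- by move=> _ _; rewrite orbC (_ : Ordinal _ = Ordinal lt_k) ?connect0 //; apply: val_inj.
- by move=> _; rewrite (_ : rev_ord _ = Ordinal lt_k) => [->|] //; apply: val_inj.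
- by move=> _ _; rewrite (_ : Ordinal _ = ord0) ?connect0 //; apply: val_inj.
- by move=> _; rewrite (_ : ordS _ = Ordinal lt_k) => [->|] //; apply: val_inj.
- by move=> _ _; rewrite orbC (_ : Ordinal _ = Ordinal lt_k) ?connect0 //; apply: val_inj.
by move=> + _; rewrite (_ : ordS _ = Ordinal lt_k) => [->|]; rewrite ?orbT //; apply: val_inj.
Qed.

Lemma touches_linked v i a b : linked v a b -> touches v i a = touches v i b.
Proof.
move=> /connect1 ab.
by rewrite /touches !(same_connect_r (connect_linked_sym v) ab).
Qed.

Definition differ_only_at v v' i := forall j, j != i -> v j = v' j.

(** A link of [v'] that is not a link of [v] joins two half-edges of the crossing [i], and both of
    these are touched. *)
Lemma touches_linked_other v v' i a b : differ_only_at v v' i ->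
  linked v' a b -> touches v i a = touches v i b.
Proof.
move=> vv'; case: a b => [x|j] [y|l] //= /orP[/eqP->|/eqP->].
  by apply: touches_linked; rewrite /= eqxx.
case: x => j k; have [->|ji] := eqVneq j i; first by rewrite /smoothing !touches_crossing.
by apply: touches_linked; rewrite /= /smoothing /= vv' // eqxx orbT.
Qed.

Lemma differ_only_at_sym v v' i : differ_only_at v v' i -> differ_only_at v' v i.
Proof. by move=> vv' j /vv'. Qed.

Lemma touches_other v v' i a : differ_only_at v v' i -> touches v' i a = touches v i a.
Proof.
have sub w w' : differ_only_at w w' i -> touches w' i a -> touches w i a.
  move=> ww' /orP[] /(connect_invariant (fun x y => touches_linked_other ww')) <-;
    exact: touches_crossing.
by move=> vv'; apply/idP/idP; apply: sub => // ? /vv'.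
Qed.

(** An untouched circle avoids all four half-edges at [i], so it uses only links common to both
    resolutions. *)
Lemma connect_untouched v v' i a b : differ_only_at v v' i -> ~~ touches v i a ->
  connect (linked v) a b = connect (linked v') a b.
Proof.
have sub w w' : differ_only_at w w' i -> ~~ touches w i a ->
    connect (linked w) a b -> connect (linked w') a b.
  move=> ww' Na ab.
  pose h x := ~~ touches w i x && connect (linked w') a x.
  suff /(connect_invariant (f := h))/(_ _ _ ab) : forall x y, linked w x y -> h x = h y.
    by rewrite /h Na connect0 => /esym/andP[].
  move=> x y xy; rewrite /h (touches_linked i xy).
  case Ny : (touches w i y) => //=.
  suff /connect1 : linked w' x y by move/(same_connect_r (connect_linked_sym w')).
  case: x y xy Ny => [[j k]|j] [y|l] //= /orP[/eqP->|/eqP->]; first by rewrite eqxx.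
  have [->|ji] := eqVneq j i; first by rewrite touches_crossing.
  by rewrite /smoothing /= ww' // eqxx orbT.
move=> vv' Na; apply/idP/idP; apply: sub => //.
  exact: differ_only_at_sym.
by rewrite (touches_other _ vv').
Qed.

End Smoothings.

(** * Changing one smoothing merges two circles or splits one *)

Section Bifurcation.

Variables (D : link_diagram) (v v' : vertex D) (i : 'I_(ncrossings D)).
Hypothesis vv' : differ_only_at v v' i.
Hypothesis vi : v i = ~~ v' i.

Local Notation p := (i, inord 0 : 'I_4).
Local Notation q := (i, inord 2 : 'I_4).

(** Both smoothings match the even half-edges of a crossing with the odd ones, in the two possible
    ways, so on even half-edges they differ by exchanging 0 and 2. The odd half-edges at [i] are
    excluded because the transposition fixes them while their partners change. *)
Lemma smoothing_swap (x : dart (ncrossings D)) :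
  (x.1 = i -> odd x.2 = false) -> smoothing v' x = smoothing v (tperm p q x).
Proof.
rewrite inord0_I4 inord2_I4; case: x => j k; rewrite /smoothing /=.
case: tpermP => [[-> ->]|[-> ->]|np nq] /=.
- by move=> _; rewrite vi; case: (v' i); congr (_, _); apply: val_inj.
- by move=> _; rewrite vi; case: (v' i); congr (_, _); apply: val_inj.
have [ji|ji] := eqVneq j i; last by rewrite vv'.
rewrite ji in np nq * => /(_ erefl); case: k np nq => [[|[|[|[|]]]] //= lt_k] np nq _.
  by case: np; congr (_, _); apply: val_inj.
by case: nq; congr (_, _); apply: val_inj.
Qed.

Section Coloured.

Variable f : dart (ncrossings D) -> bool.
Hypothesis f_edge : forall x, f (edge x) = ~~ f x.
Hypothesis f_next : forall x, f (next_dart x) = ~~ f x.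

Lemma colour_odd (x : dart (ncrossings D)) : f x = f (x.1, ord0) (+) odd x.2.
Proof.
case: x => j k /=; case: k => [[|[|[|[|]]]] //= lt_k].
- by rewrite addbF; congr (f (_, _)); apply: val_inj.
- by rewrite addbT -f_next; congr (f (_, _)); apply: val_inj.
- by rewrite addbF -[RHS]negbK -!f_next; congr (f (_, _)); apply: val_inj.
- by rewrite addbT -[f (_, ord0)]negbK -!f_next; congr (f (_, _)); apply: val_inj.
Qed.

Lemma colour_smoothing (w : vertex D) x : f (smoothing w x) = ~~ f x.
Proof.
rewrite colour_odd [f x]colour_odd /smoothing /= -addbN; congr (_ (+) _).
by case: (w x.1); case: x => j [[|[|[|[|]]]] //= lt_k].
Qed.

(* On the darts of the colour of p, this goes once along a crossing and an edge;
   restricting to one colour orients all circles coherently. *)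
Definition circle_step (w : vertex D) x :=
  if f x == f p then edge (smoothing w x) else x.

Lemma colour_circle_step w x : f (circle_step w x) = f x.
Proof.
by rewrite /circle_step; case: eqP => // _; rewrite f_edge colour_smoothing negbK.
Qed.

Lemma circle_step_inj w : injective (circle_step w).
Proof.
move=> x y E; have fE : f x = f y by rewrite -(colour_circle_step w) E colour_circle_step.
move: E; rewrite /circle_step fE; case: eqP => // _.
by move=> /(can_inj (@edgeK D)) /(can_inj (smoothingK w)).
Qed.

Definition circle_perm w := perm (@circle_step_inj w).

Lemma connect_circle_perm w x y : f x = f p -> f y = f p ->
  connect (linked w) (inl x) (inl y) = (y \in porbit (circle_perm w) x).
Proof.
move=> fx fy; set g := circle_perm w.
apply/idP/porbitP => [xy|[k ->]].
  have gO z : (g z \in porbit g x) = (z \in porbit g x).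
    by have := mem_porbit g 1 z; rewrite expg1 -eq_porbit_mem => /eqP zg;
       rewrite -!eq_porbit_mem zg.
  (* Extends the orbit of [x] to darts of the other colour through [edge]. Then [W] is constant
     along edges by construction, and along smoothings because the permutation takes one smoothing
     followed by one edge. *)
  pose W (a : Defs.arc D) := if a is inl z then
     if f z == f p then z \in porbit g x else edge z \in porbit g x
   else false.
  suff /(connect_invariant (f := W))/(_ _ _ xy) : forall a b, linked w a b -> W a = W b.
    by rewrite /W fx fy eqxx porbit_id => /esym/porbitP.
  move=> [z|?] [u|?] //= /orP[] /eqP->.
    rewrite f_edge edgeK; case: (f z) (f p) => [] [] //.
  have fsm := colour_smoothing w z.
  case fz : (f z == f p).
    have -> : (f (smoothing w z) == f p) = false by rewrite fsm (eqP fz); case: (f p).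
    by rewrite -gO permE /circle_step fz.
  have fsm' : f (smoothing w z) == f p by rewrite fsm; case: (f z) (f p) fz => [] [].
  by rewrite fsm' -[in RHS]gO permE /circle_step fsm' smoothingK.
elim: k => [|k IHk]; first by rewrite expg0 perm1.
apply: (connect_trans IHk); rewrite expgSr permM permE /circle_step.
case: eqP => _; last by rewrite connect0.
apply: (@connect_trans _ _ (inl (smoothing w ((g ^+ k)%g x)))).
  by apply: connect1; rewrite /= eqxx orbT.
by apply: connect1; rewrite /= eqxx.
Qed.

End Coloured.

Lemma bifurcation : connect (linked v) (under_in i) (under_out i) =
  ~~ connect (linked v') (under_in i) (under_out i).
Proof.
have [f [fe fn]] := diagram_checkerboard D.
have fq : f q = f p.
  by rewrite (colour_odd fn) [f p](colour_odd fn) /= !inordK.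
rewrite !(connect_circle_perm fe fn) //.
set g := circle_perm _ _ v; set g' := circle_perm _ _ v'.
have g'E : g' = (tperm p q * g)%g.
  apply/permP => x; rewrite permM [LHS]permE [RHS]permE /circle_step.
  have -> : f (tperm p q x) = f x by case: tpermP => [->|->|].
  case: eqP => [fx|fx].
    (* At the crossing [i], the darts of the colour of p are the even ones. *)
    rewrite smoothing_swap //= => xi; move: fx.
    rewrite (colour_odd fn) [f p](colour_odd fn) xi inord0_I4 /=.
    by case: (f _); case: odd.
  by case: tpermP => // xE; rewrite xE ?fq in fx.
(* Each of the two permutations is the other one times the transposition. Adding the two resulting
   relations between their numbers of cycles shows that p and q share a cycle in exactly one of
   them. *)
have := porbits_mul_tperm g p q; have := porbits_mul_tperm g' p q.
rewrite /= {1}g'E mulgA tperm2 mul1g -g'E.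
have -> : (p != q) = true by rewrite inord0_I4 inord2_I4 xpair_eqE andbF.
rewrite ![p \in _]porbit_sym.
by case: (q \in _); case: (q \in _) => //=; lia.
Qed.

End Bifurcation.

(** * Edges of the cube *)

Section CircleMatching.

Variables (D : link_diagram) (i : 'I_(ncrossings D)).

Definition untouched_circle (w : vertex D) (c : circle w) :=
  (c != circle_of w (under_in i)) && (c != circle_of w (under_out i)).

(** The same circle, seen in the other resolution. The default is a placeholder for circles without
    counterpart; [transport] is only evaluated for its meaning on untouched circles. *)
Definition transport (w w' : vertex D) (c : circle w) : circle w' :=
  odflt (circle_of w' (under_in i)) [pick c' : circle w' | val c' == val c].

Lemma untouched_circleP w a :
  untouched_circle (circle_of w a) = ~~ touches w i a.
Proof.
rewrite /untouched_circle !circle_of_eq /touches negb_or.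
by rewrite ![connect _ a _]connect_linked_sym.
Qed.

Lemma transportE (w w' : vertex D) (c : circle w) : differ_only_at w w' i ->
  untouched_circle c -> val (transport w' c) = val c.
Proof.
move=> ww'; have [a ->] := circle_ofP c; rewrite untouched_circleP => Na.
rewrite /transport; case: pickP => [c' /eqP //|] /(_ (circle_of w' a)) /eqP[].
by apply/setP => b; rewrite !inE (connect_untouched _ ww').
Qed.

(** A common circle through one of the half-edges 0 and 2 would contain the other one in both
    resolutions or in neither, against [bifurcation]. *)
Lemma common_circle_untouched (w w' : vertex D) (c : circle w) (c' : circle w') :
  differ_only_at w w' i -> w i = ~~ w' i -> val c = val c' -> untouched_circle c.
Proof.
move=> ww' wi; have [a ->] := circle_ofP c; have [b ->] := circle_ofP c'.
move=> /setP /= ab; have := bifurcation ww' wi.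
have E x y : connect (linked w) a x -> connect (linked w) x y = connect (linked w') x y.
  move=> ax; have := ab x; rewrite !inE ax => /esym bx.
  have := ab y; rewrite !inE (same_connect (connect_linked_sym w) ax).
  by rewrite (same_connect (connect_linked_sym w') bx).
rewrite untouched_circleP /touches => bif; apply/norP; split; apply/negP.
  rewrite connect_linked_sym => /(E _ (under_out i)); rewrite bif.
  by case: connect.
rewrite connect_linked_sym => /(E _ (under_in i)).
rewrite connect_linked_sym [RHS]connect_linked_sym bif.
by case: connect.
Qed.

Lemma transportK (w w' : vertex D) (c : circle w) : differ_only_at w w' i ->
  w i = ~~ w' i -> untouched_circle c ->
  untouched_circle (transport w' c) /\ transport w (transport w' c) = c.
Proof.
move=> ww' wi uc; have tc := transportE ww' uc.
have utc : untouched_circle (transport w' c).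
  apply: common_circle_untouched tc; first exact: differ_only_at_sym.
  by rewrite wi negbK.
split=> //; apply: val_inj.
by rewrite (transportE (differ_only_at_sym ww') utc).
Qed.

(** Turns the condition in [edge_coef] into prescribed labels away from the crossing, the form
    needed by the sums over labelings below. *)
Lemma agreeE (w w' : vertex D) (s : labeling (circle w)) (s' : labeling (circle w')) :
  differ_only_at w w' i -> w i = ~~ w' i ->
  [forall c : circle w, forall c' : circle w', (val c == val c') ==> (s c == s' c')] =
  [forall c, untouched_circle c ==> (s c == s' (transport w' c))].
Proof.
move=> ww' wi; apply/'forall_forallP/'forall_implyP => H c.
  by move=> uc; have /implyP := H c (transport w' c); apply; rewrite transportE.
move=> c'; apply/implyP => /eqP cc'; have uc := common_circle_untouched ww' wi cc'.
rewrite (eqP (H c uc)); apply/eqP; congr (s' _); apply: val_inj.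
by rewrite transportE.
Qed.

Lemma agreeC (w w' : vertex D) (s : labeling (circle w)) (s' : labeling (circle w')) :
  [forall c : circle w, forall c' : circle w', (val c == val c') ==> (s c == s' c')] =
  [forall c' : circle w', forall c : circle w, (val c' == val c) ==> (s' c' == s c)].
Proof.
by apply/'forall_forallP/'forall_forallP => H c c'; apply/implyP => /eqP cc';
   rewrite eq_sym; apply: (implyP (H c' c)); rewrite cc'.
Qed.

End CircleMatching.

Lemma sum_mkcondM (R : pzSemiRingType) (I : finType) (P : pred I) (F G : I -> R) :
  \sum_i (if P i then F i else 0) * G i = \sum_(i | P i) F i * G i.
Proof.
by rewrite [RHS]big_mkcond; apply: eq_bigr => i _; case: ifP => // _; rewrite mul0r.
Qed.

(** * Sums over labelings prescribed away from two given circles *)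

Section LocalSums.

Variables (R : comNzRingType) (C : finType) (P Q : C).
Variables (k : C -> bool) (w : C -> bool -> R).

Let away c := (c != P) && (c != Q).

(** The labelings that contribute are parametrised by their labels at [P] and [Q], and the product
    over the other circles is a common factor. *)
Lemma sum_labeling_away2 (l : bool -> bool -> R) : P != Q ->
  \sum_(s : labeling C)
    (if [forall c, away c ==> (s c == k c)] then l (s P) (s Q) else 0) *
      \prod_c w c (s c) =
  (\sum_a \sum_b l a b * (w P a * w Q b)) * \prod_(c | away c) w c (k c).
Proof.
move=> PQ; rewrite sum_mkcondM.
pose h (ab : bool * bool) : labeling C :=
  [ffun c => if c == P then ab.1 else if c == Q then ab.2 else k c].
have hP ab : h ab P = ab.1 by rewrite ffunE eqxx.
have hQ ab : h ab Q = ab.2 by rewrite ffunE eq_sym (negPf PQ) eqxx.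
have hk ab c : away c -> h ab c = k c.
  by case/andP => /negPf cP /negPf cQ; rewrite ffunE cP cQ.
rewrite (reindex_onto h (fun s => (s P, s Q))) => [|s /'forall_implyP sk]; last first.
  apply/ffunP => c; rewrite ffunE /=; case: eqP => [->//|/eqP cP].
  by case: eqP => [->//|/eqP cQ]; apply/esym/eqP/sk; rewrite /away cP.
rewrite pair_bigA mulr_suml; apply: eq_big => [[a b]|[a b] _].
  rewrite hP hQ eqxx andbT; apply/'forall_implyP => c ac.
  by rewrite hk.
rewrite /= hP hQ /= -mulrA; congr (_ * _).
rewrite (bigD1 P) //= (bigD1 Q) 1?eq_sym //= hP hQ mulrA; congr (_ * _).
by apply: eq_bigr => c ac; rewrite hk.
Qed.

Lemma sum_labeling_away1 (l : bool -> R) : P = Q ->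
  \sum_(s : labeling C)
    (if [forall c, away c ==> (s c == k c)] then l (s P) else 0) *
      \prod_c w c (s c) =
  (\sum_a l a * w P a) * \prod_(c | away c) w c (k c).
Proof.
move=> PQ; rewrite sum_mkcondM.
pose h a : labeling C := [ffun c => if c == P then a else k c].
have hP a : h a P = a by rewrite ffunE eqxx.
have hk a c : away c -> h a c = k c by case/andP => /negPf cP _; rewrite ffunE cP.
rewrite (reindex_onto h (fun s => s P)) => [|s /'forall_implyP sk]; last first.
  apply/ffunP => c; rewrite ffunE /=; case: eqP => [->//|/eqP cP].
  by apply/esym/eqP/sk; rewrite /away -PQ cP.
rewrite mulr_suml; apply: eq_big => [a|a _].
  rewrite hP eqxx andbT; apply/'forall_implyP => c ac.
  by rewrite hk.
rewrite /= hP -mulrA; congr (_ * _).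
rewrite (bigD1 P) //= hP; congr (_ * _).
by apply: eq_big => [c|c cP]; rewrite ?hk // /away -?PQ ?andbb // cP.
Qed.

End LocalSums.

(** * Maps acting circle by circle, and their compatibility with the edges of the cube *)

Definition circle_mx (D : link_diagram) :=
  forall v : vertex D, circle v -> bool -> bool -> Rht.

Section Intertwine.

Variables (D : link_diagram) (i : 'I_(ncrossings D)) (v v' : vertex D).
Hypothesis vv' : differ_only_at v v' i.
Hypothesis vi : v i = ~~ v' i.
Variables (theta : {rmorphism Rht -> Rht}) (M : circle_mx D).

Local Notation P := (circle_of v (under_in i)).
Local Notation Q := (circle_of v (under_out i)).
Local Notation P' := (circle_of v' (under_in i)).
Local Notation Q' := (circle_of v' (under_out i)).

Hypothesis M_common : forall (c : circle v) (c' : circle v') a b,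
  val c = val c' -> M c a b = M c' a b.
Hypothesis M_merge : P != Q -> forall a b d,
  \sum_e theta (mul_coef a b e) * M P' e d =
  \sum_a' \sum_b' mul_coef a' b' d * (M P a a' * M Q b b').
Hypothesis M_split : P' != Q' -> forall a b d,
  \sum_e \sum_f theta (comul_coef a e f) * (M P' e b * M Q' f d) =
  \sum_a' comul_coef a' b d * M P a a'.

Lemma merge_or_split : (P == Q) = (P' != Q').
Proof. by rewrite !circle_of_eq (bifurcation vv' vi). Qed.

Lemma prod_untouched (s : labeling (circle v)) (s' : labeling (circle v')) :
  \prod_(c : circle v | untouched_circle i c) M c (s c) (s' (transport i v' c)) =
  \prod_(c : circle v' | untouched_circle i c) M c (s (transport i v c)) (s' c).
Proof.
have v'v := differ_only_at_sym vv'; have v'i : v' i = ~~ v i by rewrite vi negbK.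
rewrite (reindex_onto (transport i v) (transport i v')) => [|c uc]; last first.
  exact: (transportK vv' vi uc).2.
apply: eq_big => [c|c /andP[uc /eqP ctc]].
  apply/andP/idP => [[uc /eqP <-]|uc]; first exact: (transportK vv' vi uc).1.
  by have [-> ->] := transportK v'v v'i uc.
rewrite ctc; apply: M_common.
by rewrite -[in RHS]ctc (transportE vv' uc).
Qed.

(** Both sides factor into a local sum at the crossing and a product over untouched circles. The
    products agree by [prod_untouched], and the local sums by [M_merge] or [M_split]. *)
Lemma edge_coef_intertwine (s : labeling (circle v)) (s'' : labeling (circle v')) :
  \sum_(s' : labeling (circle v'))
     theta (edge_coef i s s') * \prod_c M c (s' c) (s'' c) =
  \sum_(s0 : labeling (circle v)) edge_coef i s0 s'' * \prod_c M c (s c) (s0 c).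
Proof.
have v'v := differ_only_at_sym vv'; have v'i : v' i = ~~ v i by rewrite vi negbK.
rewrite /edge_coef -/(under_in i) -/(under_out i).
under eq_bigr do rewrite agreeC (agreeE _ _ v'v v'i) (fun_if theta) rmorph0.
under [RHS]eq_bigr do rewrite (agreeE _ _ vv' vi).
have [PQ|PQ] := boolP (P != Q).
  have PQ' : P' = Q' by apply/eqP; move: merge_or_split; rewrite (negPf PQ); case: eqP.
  rewrite (sum_labeling_away2 (fun c => s'' (transport i v' c)) (fun c => M c (s c))
    (fun a b => mul_coef a b (s'' P')) PQ).
  rewrite (sum_labeling_away1 (fun c => s (transport i v c)) (fun c a => M c a (s'' c))
    (fun a => theta (mul_coef (s P) (s Q) a)) PQ').
  by rewrite M_merge // prod_untouched.
have PQ' : P' != Q' by rewrite -merge_or_split (negbNE PQ).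
rewrite (sum_labeling_away1 (fun c => s'' (transport i v' c)) (fun c => M c (s c))
    (fun a => comul_coef a (s'' P') (s'' Q')) (eqP (negbNE PQ))).
rewrite (sum_labeling_away2 (fun c => s (transport i v c)) (fun c a => M c a (s'' c))
    (fun a b => theta (comul_coef (s P) a b)) PQ').
by rewrite M_split // prod_untouched.
Qed.

End Intertwine.

(** The theta-semilinear map given on each tensor power by the tensor product of the matrices
    [M v c]. Both sigma and multiplication by X at a point have this form. *)
Definition circlewise (D : link_diagram) (theta : Rht -> Rht) (M : circle_mx D)
    (x : CKh D) : CKh D :=
  of_components (fun v => [ffun s' : labeling (circle v) =>
    \sum_(s : labeling (circle v)) theta (component x v s) * \prod_c M v c (s c) (s' c)]).

(* The circles through p and q stand for those merged or split by an edge v -> v'. *)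
Definition intertwines (D : link_diagram) (theta : Rht -> Rht) (M : circle_mx D) :=
  forall (v v' : vertex D) (p q : Defs.arc D),
  [/\ forall (c : circle v) (c' : circle v') a b, val c = val c' ->
        M v c a b = M v' c' a b,
     circle_of v p != circle_of v q -> circle_of v' p = circle_of v' q ->
       val (circle_of v' p) = val (circle_of v p) :|: val (circle_of v q) ->
       forall a b d,
       \sum_e theta (mul_coef a b e) * M v' (circle_of v' p) e d =
       \sum_a' \sum_b' mul_coef a' b' d *
         (M v (circle_of v p) a a' * M v (circle_of v q) b b')
   & circle_of v' p != circle_of v' q -> circle_of v p = circle_of v q ->
       val (circle_of v p) = val (circle_of v' p) :|: val (circle_of v' q) ->
       forall a b d,
       \sum_e \sum_f theta (comul_coef a e f) *
         (M v' (circle_of v' p) e b * M v' (circle_of v' q) f d) =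
       \sum_a' comul_coef a' b d * M v (circle_of v p) a a'].

Lemma touches_circle D (v : vertex D) i a :
  (a \in val (circle_of v (under_in i)) :|: val (circle_of v (under_out i))) = touches v i a.
Proof. by rewrite !inE. Qed.

Lemma component_differential D (x : CKh D) v' s' :
  component (differential x) v' s' =
  \sum_(i | v' i) edge_sign v' i * edge_map v' i (component x (unset_bit v' i)) s'.
Proof. by rewrite !ffunE. Qed.

Lemma component_circlewise D theta (M : circle_mx D) (x : CKh D) v s' :
  component (circlewise theta M x) v s' =
  \sum_(s : labeling (circle v)) theta (component x v s) * \prod_c M v c (s c) (s' c).
Proof. by rewrite !ffunE. Qed.

Lemma circlewise_differential D (theta : {rmorphism Rht -> Rht}) (M : circle_mx D) x :
  intertwines theta M ->
  circlewise theta M (differential x) = differential (circlewise theta M x).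
Proof.
move=> tM; apply/ffunP => -[v' s'']; rewrite !ffunE /=.
under [LHS]eq_bigr do rewrite component_differential rmorph_sum mulr_suml.
rewrite exchange_big /=; apply: eq_bigr => i v'i.
rewrite !ffunE; set v := unset_bit v' i.
have vv' : differ_only_at v v' i by move=> j ji; rewrite ffunE ji.
have vi : v i = ~~ v' i by rewrite ffunE eqxx v'i.
under [LHS]eq_bigr do rewrite rmorphM rmorph_sign -mulrA ffunE rmorph_sum.
rewrite -mulr_sumr; congr (_ * _).
under [LHS]eq_bigr do rewrite mulr_suml; rewrite exchange_big /=.
transitivity (\sum_(s : labeling (circle v)) theta (component x v s) *
   \sum_(s' : labeling (circle v'))
     theta (edge_coef i s s') * \prod_c M v' c (s' c) (s'' c)).
  apply: eq_bigr => s _; rewrite mulr_sumr; apply: eq_bigr => s' _.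
  by rewrite rmorphM mulrA.
have [M1 M2 M3] := tM v v' (under_in i) (under_out i).
(* The circles at the crossing cover the same arcs before and after, so the single circle on one
   side is the union of the two on the other. *)
have U : val (circle_of v (under_in i)) :|: val (circle_of v (under_out i)) =
         val (circle_of v' (under_in i)) :|: val (circle_of v' (under_out i)).
  by apply/setP => a; rewrite !touches_circle (touches_other _ vv').
have mos := merge_or_split vv' vi.
under [LHS]eq_bigr => s _.
  rewrite (edge_coef_intertwine (theta := theta) (M := M) vv' vi M1).
  - by over.
  - move=> PQ; move: mos; rewrite (negPf PQ) => /esym/negbFE/eqP PQ'.
    by apply: M2 => //; rewrite U -PQ' setUid.
  move=> PQ'; move: mos; rewrite PQ' => /eqP PQ.
  by apply: M3 => //; rewrite -U -PQ setUid.
under [LHS]eq_bigr do rewrite mulr_sumr; rewrite exchange_big /=.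
apply: eq_bigr => s0 _; rewrite component_circlewise mulr_suml; apply: eq_bigr => s _.
by rewrite mulrCA mulrA [in RHS]mulrC mulrA.
Qed.

(** * The involution sigma and multiplication by X *)

HB.instance Definition _ := GRing.RMorphism.copy sigma0 (comp_poly (- 'X : Rht)).

Lemma sigma0_h : sigma0 hvar = - hvar.
Proof. exact: comp_polyX. Qed.

Lemma sigma0_t : sigma0 tvar = tvar.
Proof. exact: comp_polyC. Qed.

Lemma sigma0K : involutive sigma0.
Proof.
move=> r; rewrite /sigma0 -comp_polyA.
by rewrite raddfN /= comp_polyX opprK comp_polyXr.
Qed.

Lemma mul_coefE a b c : mul_coef a b c =
  match a, b, c with
  | false, false, false | false, true, true | true, false, true => 1
  | true, true, false => tvar
  | true, true, true => hvar
  | _, _, _ => 0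
  end.
Proof.
rewrite /mul_coef; case: a; last first.
  by rewrite [Abasis false * _]mul1r Acoord_Abasis; case: b; case: c.
case: b; last by rewrite [_ * Abasis false]mulr1 Acoord_Abasis; case: c.
rewrite -[Abasis true * _]/(Xgen * Xgen) -expr2 Xgen_sqr raddfD /= !AcoordZ.
rewrite -[Xgen]/(Abasis true) -[1]/(Abasis false) !Acoord_Abasis.
by case: c; rewrite /= ?mulr1 ?mulr0 ?addr0 ?add0r.
Qed.

Definition sigma_coef (a b : bool) : Rht := Acoord b (sigma1 (Abasis a)).

Lemma sigma_coefE a b : sigma_coef a b =
  match a, b with
  | false, true => 0
  | true, false => - hvar
  | _, _ => 1
  end.
Proof.
rewrite /sigma_coef sigma1_Abasis; case: a; last first.
  by rewrite -[_ ^+ _]/(Abasis false) Acoord_Abasis; case: b.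
rewrite -[(_ - _) ^+ _]/(Xgen - hvar%:A) raddfB /= AcoordZ.
rewrite -[Xgen]/(Abasis true) -[1]/(Abasis false).
by rewrite !Acoord_Abasis; case: b; rewrite /= ?mulr1 ?mulr0 ?sub0r ?subr0.
Qed.

Lemma sum_bool2 (V : nmodType) (F : bool -> bool -> V) :
  \sum_a \sum_b F a b = F true true + F true false + (F false true + F false false).
Proof. by rewrite !big_bool. Qed.

Section Circlewise.

Variable D : link_diagram.
Implicit Types (x : CKh D) (M : circle_mx D).

Lemma eq_circlewise (theta theta' : Rht -> Rht) M M' x : theta =1 theta' ->
  (forall v c a b, M v c a b = M' v c a b) ->
  circlewise theta M x = circlewise theta' M' x.
Proof.
move=> tt MM; apply/ffunP => g; rewrite !ffunE; apply: eq_bigr => s _.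
by rewrite tt; congr (_ * _); apply: eq_bigr => c _; apply: MM.
Qed.

(** A composite of tensor products of matrices is the tensor product of the matrix products;
    semilinearity of the outer map applies [theta] to the entries of the inner matrix. *)
Lemma circlewise_comp (theta theta' : {rmorphism Rht -> Rht}) M M' x :
  circlewise theta M (circlewise theta' M' x) =
  circlewise (theta \o theta')
    (fun v c a b => \sum_d theta (M' v c a d) * M v c d b) x.
Proof.
apply/ffunP => -[v s'']; rewrite !ffunE /=.
under [LHS]eq_bigr do rewrite component_circlewise rmorph_sum mulr_suml.
rewrite exchange_big /=; apply: eq_bigr => s _.
rewrite bigA_distr_bigA mulr_sumr; apply: eq_bigr => s' _.
by rewrite rmorphM rmorph_prod -mulrA -big_split.
Qed.

Lemma circlewise_id x : circlewise id (fun v c a b => (a == b)%:R) x = x.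
Proof.
apply/ffunP => -[v s']; rewrite ffunE /= ffunE (bigD1 s') //= [X in _ + X]big1 => [|s ss'].
  by rewrite addr0 ffunE big1 ?mulr1 // => c _; rewrite eqxx.
have [c /negPf sc] : exists c, s c != s' c.
  apply/existsP; apply: contraNT ss' => /existsPn ss.
  by apply/eqP/ffunP => c; move/eqP: (negbNE (ss c)).
by rewrite (bigD1 c) //= sc mul0r mulr0.
Qed.

Definition hscale x : CKh D := [ffun g => hvar * x g].

Lemma hscale_inj : injective hscale.
Proof.
move=> x y /ffunP xy; apply/ffunP => g; move: (xy g); rewrite !ffunE.
by apply: mulfI; rewrite polyX_eq0.
Qed.

Lemma hscale_differential x : differential (hscale x) = hscale (differential x).
Proof.
apply/ffunP => -[v s]; rewrite !ffunE /= mulr_sumr; apply: eq_bigr => i _.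
rewrite mulrCA !ffunE; congr (_ * _); rewrite mulr_sumr; apply: eq_bigr => s' _.
by rewrite !ffunE mulrA.
Qed.

Lemma hscaleB x y : hscale (x - y) = hscale x - hscale y.
Proof. by apply/ffunP => g; rewrite !ffunE mulrBr. Qed.

Lemma hscaleD x y : hscale (x + y) = hscale x + hscale y.
Proof. by apply/ffunP => g; rewrite !ffunE mulrDr. Qed.

Lemma circlewise_hscale (theta : {rmorphism Rht -> Rht}) M x e :
  theta hvar = e * hvar ->
  circlewise theta M (hscale x) = [ffun g => e * hscale (circlewise theta M x) g].
Proof.
move=> te; apply/ffunP => -[v s]; rewrite !ffunE /= mulrA mulr_sumr.
by apply: eq_bigr => s' _; rewrite !ffunE rmorphM te !mulrA.
Qed.

Lemma circlewiseB (theta : {rmorphism Rht -> Rht}) M x y :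
  circlewise theta M (x - y) = circlewise theta M x - circlewise theta M y.
Proof.
apply/ffunP => -[v s]; rewrite !ffunE /= -sumrB; apply: eq_bigr => s' _.
by rewrite !ffunE rmorphB mulrBl.
Qed.

Definition sigma : CKh D -> CKh D := circlewise sigma0 (fun v c => sigma_coef).

(** Since [hscale] is injective, the identities for [nu] are deduced from those for [sigma] by
    multiplying by h. *)
Lemma hscale_nu x : hscale (nu x) = x - sigma x.
Proof.
apply/ffunP => -[v s]; rewrite [LHS]ffunE [nu x _]ffunE /= tnuP !ffunE /=.
by congr (_ - _); apply: eq_bigr => s' _; rewrite [pure_tensor _ _]ffunE.
Qed.

Lemma sigmaK : involutive sigma.
Proof.
move=> x; rewrite /sigma circlewise_comp -[RHS]circlewise_id.
apply: eq_circlewise => [r|v c a b]; first exact: sigma0K.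
rewrite big_bool /= !sigma_coefE.
by case: a; case: b; rewrite ?rmorph0 ?rmorph1 ?rmorphN /= ?sigma0_h; ring.
Qed.

Lemma sigma_intertwines : intertwines sigma0 (fun (v : vertex D) c => sigma_coef).
Proof.
move=> v v' p q; split; first by [].
  move=> _ _ _ a b d; rewrite !big_bool !sigma_coefE !mul_coefE.
  by case: a; case: b; case: d; rewrite ?rmorph0 ?rmorph1 ?rmorphN /= ?sigma0_h ?sigma0_t; ring.
move=> _ _ _ a b d; rewrite sum_bool2 big_bool !sigma_coefE /comul_coef.
by case: a; case: b; case: d; rewrite ?rmorph0 ?rmorph1 ?rmorphN /= ?sigma0_h ?sigma0_t; ring.
Qed.

Lemma sigma_differential x : sigma (differential x) = differential (sigma x).
Proof. exact: circlewise_differential sigma_intertwines. Qed.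

Lemma nu_differential x : nu (differential x) = differential (nu x).
Proof.
apply: hscale_inj; rewrite [LHS]hscale_nu sigma_differential.
by rewrite -raddfB -hscale_nu; apply: hscale_differential.
Qed.

Lemma sigmaB x y : sigma (x - y) = sigma x - sigma y.
Proof. exact: circlewiseB. Qed.

Lemma subrACA (V : zmodType) (a b c d : V) : a - b - (c - d) = a - c - (b - d).
Proof. by rewrite !opprD addrACA. Qed.

Lemma nuB x y : nu (x - y) = nu x - nu y.
Proof.
apply: hscale_inj; rewrite [LHS]hscale_nu [RHS]hscaleB sigmaB.
apply: etrans (subrACA _ _ _ _) _.
exact/esym/(congr2 (fun a b : CKh D => a - b) (hscale_nu x) (hscale_nu y)).
Qed.

Lemma sigma_hscale x : sigma (hscale x) = - hscale (sigma x).
Proof.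
have te : sigma0 hvar = -1 * hvar by rewrite sigma0_h mulN1r.
rewrite [LHS](circlewise_hscale _ _ te).
by apply/ffunP => g; rewrite [LHS]ffunE mulN1r [RHS]ffunE.
Qed.

Lemma sigma_nu x : sigma (nu x) = nu x.
Proof.
have : sigma (hscale (nu x)) = - hscale (nu x).
  by rewrite [hscale (nu x)]hscale_nu sigmaB sigmaK opprB.
by rewrite sigma_hscale => /oppr_inj/hscale_inj.
Qed.

Lemma nu_nu x : nu (nu x) = 0.
Proof.
apply: hscale_inj; rewrite [LHS]hscale_nu sigma_nu subrr.
by apply/ffunP => g; rewrite !ffunE mulr0.
Qed.

End Circlewise.

(** * Multiplication by X on the circle through a point *)

Definition mark_coef (marked a b : bool) : Rht :=
  if marked then mul_coef true a b else (a == b)%:R.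

Lemma mark_coefE m a b : mark_coef m a b =
  match m, a, b with
  | true, true, true => hvar
  | true, true, false => tvar
  | true, false, true | false, true, true | false, false, false => 1
  | _, _, _ => 0
  end.
Proof. by rewrite /mark_coef mul_coefE; case: m; case: a; case: b. Qed.

(** This is m(Xa (x) b) = X m(a (x) b) and its mirror image. Two marks are excluded: they would
    produce a factor X^2 on the left factors but only X on the merged circle. *)
Lemma mark_coef_merge m n a b d : ~~ (m && n) ->
  \sum_e mul_coef a b e * mark_coef (m || n) e d =
  \sum_a' \sum_b' mul_coef a' b' d * (mark_coef m a a' * mark_coef n b b').
Proof.
rewrite sum_bool2 big_bool !mark_coefE !mul_coefE.
by case: m; case: n => // _; case: a; case: b; case: d => /=; ring.
Qed.

(** Delta is a map of A-bimodules, so the X may be placed on whichever of the two new circles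
    carries the mark. *)
Lemma mark_coef_split m n a b d : ~~ (m && n) ->
  \sum_e \sum_f comul_coef a e f * (mark_coef m e b * mark_coef n f d) =
  \sum_a' comul_coef a' b d * mark_coef (m || n) a a'.
Proof.
rewrite sum_bool2 big_bool !mark_coefE /comul_coef.
by case: m; case: n => // _; case: a; case: b; case: d => /=; ring.
Qed.

Lemma prod_differ_at (R : comNzRingType) (C : finType) (c0 : C) (F G H : C -> R) h :
  (forall c, c != c0 -> F c = H c) -> (forall c, c != c0 -> G c = H c) ->
  F c0 = G c0 - h * H c0 ->
  \prod_c F c = \prod_c G c - h * \prod_c H c.
Proof.
move=> FH GH F0; rewrite (bigD1 c0) // [\prod_c G c](bigD1 c0) // [\prod_c H c](bigD1 c0) //=.
rewrite (eq_bigr _ FH) (eq_bigr _ GH) F0.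
by rewrite mulrBl mulrA.
Qed.

Section Marking.

Variables (D : link_diagram) (a0 : Defs.arc D).
Implicit Types x : CKh D.

Definition mark_mx : circle_mx D := fun v c => mark_coef (a0 \in val c).

Definition mark : CKh D -> CKh D := circlewise idfun mark_mx.

Lemma mem_circle_of (v : vertex D) a :
  (a0 \in val (circle_of v a)) = (circle_of v a0 == circle_of v a).
Proof. by rewrite inE circle_of_eq connect_linked_sym. Qed.

Lemma mark_intertwines : intertwines idfun mark_mx.
Proof.
have disj (v : vertex D) p q : circle_of v p != circle_of v q ->
    ~~ ((a0 \in val (circle_of v p)) && (a0 \in val (circle_of v q))).
  by rewrite !mem_circle_of; apply: contra => /andP[/eqP<- /eqP<-].
move=> v v' p q; split.
- by move=> c c' a b cc'; rewrite /mark_mx cc'.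
- move=> pq _ U a b d; rewrite /mark_mx U in_setU.
  exact/mark_coef_merge/disj.
move=> pq _ U a b d; rewrite /mark_mx U in_setU.
exact: (mark_coef_split _ _ _ (disj v' p q pq)).
Qed.

Lemma mark_differential x : mark (differential x) = differential (mark x).
Proof. exact: (circlewise_differential _ mark_intertwines). Qed.

Lemma markB x y : mark (x - y) = mark x - mark y.
Proof. exact: circlewiseB. Qed.

Lemma mark_hscale x : mark (hscale x) = hscale (mark x).
Proof.
have te : idfun hvar = 1 * hvar by rewrite mul1r.
rewrite [LHS](circlewise_hscale _ _ te).
by apply/ffunP => g; rewrite [LHS]ffunE mul1r.
Qed.

(** On the marked circle this is sigma1(Xa) = (X - h) sigma1(a). The other factors agree, so the
    identity passes to the tensor product by linearity in one factor. *)
Lemma sigma_mark x : sigma (mark x) = mark (sigma x) - hscale (sigma x).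
Proof.
rewrite /sigma /mark !circlewise_comp.
apply/ffunP => -[v s']; rewrite !ffunE /= mulr_sumr -sumrB.
apply: eq_bigr => s _; rewrite [X in _ = _ - X]mulrCA -mulrBr; congr (_ * _).
have rest (c : circle v) : c != circle_of v a0 -> (a0 \in val c) = false.
  have [a ->] := circle_ofP c; rewrite mem_circle_of eq_sym; exact: negPf.
apply: (prod_differ_at (c0 := circle_of v a0)) => [c /rest ac|c /rest ac|].
- rewrite big_bool /mark_mx ac !mark_coefE !sigma_coefE.
  by case: (s c); case: (s' c); rewrite /= ?rmorph0 ?rmorph1; ring.
- rewrite big_bool /mark_mx ac !mark_coefE !sigma_coefE.
  by case: (s c); case: (s' c) => /=; ring.
rewrite !big_bool /mark_mx mem_circle_of eqxx !mark_coefE !sigma_coefE.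
by case: (s _); case: (s' _);
   rewrite /= ?rmorph0 ?rmorph1 ?sigma0_h ?sigma0_t; ring.
Qed.

Lemma nu_mark x : nu (mark x) = x + (mark (nu x) - hscale (nu x)).
Proof.
(* Used with d = h x: adding and subtracting it makes x - sigma x = h nu(x) appear inside the last
   term. *)
have H (V : zmodType) (a b c d : V) : a - (b - c) = d + (a - b - (d - c)).
  by rewrite !opprB [RHS]addrC -[RHS]addrA subrK addrA addrAC.
apply: hscale_inj; rewrite [LHS]hscale_nu sigma_mark.
have E1 : hscale (mark (nu x)) = mark x - mark (sigma x).
  by rewrite -mark_hscale hscale_nu markB.
have E2 : hscale (hscale (nu x)) = hscale x - hscale (sigma x).
  by rewrite [hscale (nu x)]hscale_nu hscaleB.
have E3 := etrans (hscaleB _ _) (congr2 (fun a b : CKh D => a - b) E1 E2).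
apply: etrans (H _ _ _ _ (hscale x)) _.
exact: esym (etrans (hscaleD _ _) (congr1 (fun a : CKh D => hscale x + a) E3)).
Qed.

End Marking.

(** * Maps induced in homology *)

Section Homology.

Variables (V : zmodType) (d : {additive V -> V}).

Lemma homology_class_surj (y : homology d) : exists z, y = homology_class z.
Proof. by exists (repr y); rewrite /homology_class reprK. Qed.

Lemma homology_classB (z z' : cycle_of d) :
  homology_class (z - z') = homology_class z - homology_class z'.
Proof. exact: raddfB. Qed.

Lemma homology_class_eq0 (z : cycle_of d) :
  homology_class z = 0 <-> exists y, d y = chain z.
Proof.
have <- : homology_class (0 : cycle_of d) = 0.
  by have := homology_classB (0 : cycle_of d) 0; rewrite !subrr.
split=> [/homology_classP|] [y dy]; first by exists y; rewrite dy subr0.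
by apply/homology_classP; exists y; rewrite dy subr0.
Qed.

Lemma chain_cycle (z : cycle_of d) : d (chain z) = 0.
Proof. exact/eqP/chainP. Qed.

Variable f : V -> V.
Hypothesis fB : zmod_morphism f.
Hypothesis fd : forall x, f (d x) = d (f x).

Lemma commuting_cycle (z : cycle_of d) : f (chain z) \in cycle_pred d.
Proof.
have f0 : f 0 = 0 by rewrite -[0 in LHS](subrr 0) fB subrr.
by rewrite unfold_in /cycle_pred -fd chain_cycle f0.
Qed.

Definition cycle_map (z : cycle_of d) : cycle_of d := Cycle (commuting_cycle z).

Definition homology_map (y : homology d) : homology d :=
  homology_class (cycle_map (repr y)).

(** Independence of the representative: a boundary d y goes to the boundary d (f y). *)
Lemma homology_mapE z : homology_map (homology_class z) = homology_class (cycle_map z).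
Proof.
have /homology_classP[y dy] : homology_class (repr (homology_class z)) = homology_class z.
  by rewrite /homology_class reprK.
by apply/homology_classP; exists (f y); rewrite -fd dy fB.
Qed.

Lemma homology_map_is_zmod_morphism : zmod_morphism homology_map.
Proof.
move=> y y'; have [z ->] := homology_class_surj y; have [z' ->] := homology_class_surj y'.
rewrite -homology_classB !homology_mapE -homology_classB; congr homology_class.
by apply: val_inj; rewrite /= fB.
Qed.

HB.instance Definition _ := GRing.isZmodMorphism.Build (homology d) (homology d)
  homology_map homology_map_is_zmod_morphism.

End Homology.

(** * Degrees *)

Definition homogeneous (n : int) (r : Rht) : Prop :=
  forall a b, r`_a`_b != 0 -> (2 * a + 4 * b)%:Z = n.

Lemma sum_neq0 (V : nmodType) (I : Type) (s : seq I) (P : pred I) (F : I -> V) :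
  \sum_(k <- s | P k) F k != 0 -> exists k, F k != 0.
Proof.
move=> nz; apply: contrapT => nF; case/eqP: nz; apply: big1 => k _.
by apply: contrapT => /eqP Fk; apply: nF; exists k.
Qed.

Lemma homogeneous1 : homogeneous 0 1.
Proof.
move=> a b; rewrite coef1; case: a => [|a]; last by rewrite coef0 eqxx.
by rewrite coef1; case: b.
Qed.

Lemma homogeneous0 n : homogeneous n 0.
Proof. by move=> a b; rewrite !coef0 eqxx. Qed.

Lemma homogeneous_opp_h : homogeneous 2 (- hvar).
Proof.
move=> a b; rewrite coefN coefX; case: (a =P 1%N) => [->|_]; last by rewrite oppr0 coef0 eqxx.
by rewrite coefN coef1 oppr_eq0; case: b.
Qed.

Lemma homogeneousM m n (p q : Rht) :
  homogeneous m p -> homogeneous n q -> homogeneous (m + n) (p * q).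
Proof.
move=> hp hq a b; rewrite coefM coef_sum => /sum_neq0[k].
rewrite coefM => /sum_neq0[l]; rewrite mulf_eq0 negb_or => /andP[/hp <- /hq <-].
have := ltn_ord k; have := ltn_ord l; lia.
Qed.

Lemma homogeneous_prod (I : finType) (n : I -> int) (F : I -> Rht) :
  (forall k, homogeneous (n k) (F k)) -> homogeneous (\sum_k n k) (\prod_k F k).
Proof.
move=> hF; apply: (big_ind2 homogeneous) => //; first exact: homogeneous1.
by move=> *; apply: homogeneousM.
Qed.

(** The coefficient of h^a is only multiplied by (-1)^a, so no new monomial appears. *)
Lemma homogeneous_sigma0 n (r : Rht) : homogeneous n r -> homogeneous n (sigma0 r).
Proof.
move=> hr a b nz; apply: hr; apply: contraNneq nz => rab.
rewrite /sigma0 comp_polyE coef_sum coef_sum big1 // => k _.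
rewrite exprNn coefZ -signr_odd mulr_sign.
have -> : (if odd k then - 'X^k else 'X^k)`_a = (-1) ^+ odd k * (a == k)%:R :> {poly int}.
  by case: (odd k); rewrite ?coefN coefXn ?mulN1r ?mul1r.
case: eqP => [<-|]; last by rewrite !mulr0 coef0.
by rewrite mulr1 mulrC mulr_sign; case: odd; rewrite ?coefN rab ?oppr0.
Qed.

Definition label_deg (b : bool) : int := if b then 1 else -1.

Lemma homogeneous_sigma_coef a b :
  homogeneous (label_deg a - label_deg b) (sigma_coef a b).
Proof.
rewrite sigma_coefE; case: a; case: b => /=.
- by rewrite subrr; apply: homogeneous1.
- exact: homogeneous_opp_h.
- exact: homogeneous0.
by rewrite subrr; apply: homogeneous1.
Qed.

Section Bidegree.

Variable D : link_diagram.
Implicit Types x : CKh D.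

Lemma qdegE (g : generator D) a b : qdeg g a b = (2 * a + 4 * b)%:Z + qdeg g 0 0.
Proof. by rewrite /qdeg -!addrA; congr (_ + _); rewrite add0r. Qed.

Lemma bihomogeneous_sigma i j x : bihomogeneous i j x -> bihomogeneous i j (sigma x).
Proof.
move=> hx [v s'] a b; rewrite ffunE /= ffunE !coef_sum => /sum_neq0[s nz].
(* A nonzero coefficient of [x] at the source labeling is needed to read off the homological degree
   from [hx]. *)
have [c [e xce]] : exists c e, (component x v s)`_c`_e != 0.
  apply: contrapT => no; case/eqP: nz.
  suff -> : component x v s = 0 by rewrite rmorph0 mul0r !coef0.
  apply/polyP => c; apply/polyP => e; rewrite !coef0; apply: contrapT => /eqP ce.
  by apply: no; exists c, e.
rewrite ffunE in xce; have [hi _] := hx _ _ _ xce; split=> //.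
have hxs : homogeneous (j - qdeg (Tagged (fun v => labeling (circle v)) s) 0 0)
    (component x v s).
  by move=> c' e'; rewrite ffunE => /hx[_ <-]; rewrite [in RHS]qdegE addrK.
have := homogeneousM (homogeneous_sigma0 hxs)
  (homogeneous_prod (fun c0 => @homogeneous_sigma_coef (s c0) (s' c0))).
move=> /(_ _ _ nz) E; rewrite qdegE E sumrB /qdeg /= /label_deg /weight /=.
ring.
Qed.

(** The coefficient of h^a in nu(x) is that of h^(a+1) in x - sigma x, and h has degree 2. *)
Lemma bihomogeneous_nu i j x : bihomogeneous i j x -> bihomogeneous i (j - 2) (nu x).
Proof.
move=> hx g a b nz.
have subE (y z : CKh D) : (y - z) g = y g - z g by rewrite !ffunE.
have hE (y : CKh D) : hscale y g = y g * 'X by rewrite ffunE mulrC.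
have E : (nu x g)`_a = (x g)`_a.+1 - (sigma x g)`_a.+1.
  have := congr1 (fun y : CKh D => (y g)`_a.+1) (hscale_nu x).
  by rewrite subE hE coefMX coefB.
have [hi hj] : hdeg g = i /\ qdeg g a.+1 b = j.
  have [xg|xg] := eqVneq ((x g)`_a.+1`_b) 0; last exact: hx xg.
  apply: (bihomogeneous_sigma hx); apply: contraNneq nz => sg.
  by rewrite E coefB xg sg subrr.
split=> //; rewrite -hj qdegE [in RHS]qdegE; lia.
Qed.

End Bidegree.

(** * A base point and the contraction of the homology *)

Lemma nonempty_arc D : nonempty_diagram D -> inhabited (Defs.arc D).
Proof.
rewrite /nonempty_diagram; case: (posnP (ncrossings D)) => [->|n0 _].
  by rewrite add0n => c0; split; exact: (inr (Ordinal c0)).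
by split; exact: (inl (Ordinal n0, ord0)).
Qed.

Theorem proposition2p7 (D : link_diagram) (hD : nonempty_diagram D) :
  exists nuH : {additive Kh D -> Kh D},
    [/\ induces (@nu D) nuH,
        (forall (i j : int) (y : Kh D),
           Kh_bihomogeneous i j y -> Kh_bihomogeneous i (j - 2) (nuH y)),
        (forall y : Kh D, nuH (nuH y) = 0)
      & (forall y : Kh D, nuH y = 0 <-> exists x : Kh D, nuH x = y)].
Proof.
pose nuC := cycle_map (@nuB D) (@nu_differential D).
pose nuH : {additive Kh D -> Kh D} := homology_map (@nuB D) (@nu_differential D).
have nuHE z : nuH (homology_class z) = homology_class (nuC z) by apply: homology_mapE.
have nu2 y : nuH (nuH y) = 0.
  have [z ->] := homology_class_surj y; rewrite !nuHE.
  by apply/homology_class_eq0; exists 0; rewrite raddf0 /= nu_nu.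
exists nuH; split=> //.
- by move=> z; exists (nuC z).
- move=> i j _ [z hz <-]; exists (nuC z) => //.
  exact: bihomogeneous_nu.
move=> y; split=> [|[x <-]]; last exact: nu2.
have [z ->] := homology_class_surj y; rewrite nuHE => /homology_class_eq0[w dw].
have [a] := nonempty_arc hD.
(* With nu(z) = d w, the preimage of the class of z is the class of X_a z: nu(X_a z) - z = X_a nu(z)
   - h nu(z) = d(X_a w - h w). *)
exists (homology_class (cycle_map (@markB D a) (@mark_differential D a) z)).
rewrite nuHE; apply/homology_classP; exists (mark a w - hscale w).
rewrite raddfB /= -mark_differential hscale_differential dw nu_mark.
by rewrite addrAC subrr add0r.
Qed.
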